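(* There exists an automorphism of $U_4$ which cannot be extended to an automorphism of $P_4$; that is, there exists $\psi\in\operatorname{Aut}(U_4)$ such that no automorphism of $P_4$ has restriction to $U_4$ equal to $\psi$.
   Context: $B_4$ is the Artin braid group with standard generators $\sigma_1,\sigma_2,\sigma_3$, and $P_4$ is the pure braid group, the kernel of $B_4\to S_4$, $\sigma_i\mapsto(i\ i+1)$. It is generated by $A_{i,j}=\sigma_{j-1}\cdots\sigma_{i+1}\sigma_i^2\sigma_{i+1}^{-1}\cdots\sigma_{j-1}^{-1}$, $1\le i<j\le 4$. $U_4=\langle A_{1,4},A_{2,4},A_{3,4}\rangle$ is a normal subgroup of $P_4$, free of rank 3. *)

(* Defs.v *)
From HB Require Import structures.
From mathcomp Require Import all_boot all_fingroup generic_quotient.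
From mathcomp Require Import boolp.
Set Implicit Arguments.
Unset Strict Implicit.
Unset Printing Implicit Defensive.

Local Open Scope group_scope.
Local Open Scope quotient_scope.

(* A group presentation < I | R >: (i, false) stands for the generator i,     *)
(* (i, true) for its inverse, and R u v for the relation u = v.               *)
Definition word (I : choiceType) := seq (I * bool).

Inductive word_eqv (I : choiceType) (R : word I -> word I -> Prop) :
    word I -> word I -> Prop :=
| Weqv_refl u : word_eqv R u u
| Weqv_sym u v : word_eqv R u v -> word_eqv R v u
| Weqv_trans v u w : word_eqv R u v -> word_eqv R v w -> word_eqv R u w
| Weqv_cat u1 v1 u2 v2 :
    word_eqv R u1 v1 -> word_eqv R u2 v2 -> word_eqv R (u1 ++ u2) (v1 ++ v2)
| Weqv_cancel i b : word_eqv R [:: (i, b); (i, ~~ b)] [::]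
| Weqv_rel u v : R u v -> word_eqv R u v.

Section Presented.
Variables (I : choiceType) (R : word I -> word I -> Prop).

Definition word_eqb : rel (word I) := fun u v => `[< word_eqv R u v >].

Lemma word_eqb_refl : reflexive word_eqb.
Proof. by move=> u; apply/asboolP/Weqv_refl. Qed.
Lemma word_eqb_sym : symmetric word_eqb.
Proof. by move=> u v; apply/asboolP/asboolP; apply: Weqv_sym. Qed.
Lemma word_eqb_trans : transitive word_eqb.
Proof.
move=> v u w /asboolP uv /asboolP vw; apply/asboolP; exact: Weqv_trans uv vw.
Qed.
Canonical word_equiv :=
  EquivRel word_eqb word_eqb_refl word_eqb_sym word_eqb_trans.

Definition presented := {eq_quot word_equiv}.
HB.instance Definition _ := Choice.on presented.

Definition winv (u : word I) : word I := rev [seq (a.1, ~~ a.2) | a <- u].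

Definition pclass (u : word I) : presented := \pi_({eq_quot word_equiv}) u.
Definition prepr (x : presented) : word I := repr x.

Lemma prepr_pclass u : word_eqv R (prepr (pclass u)) u.
Proof.
by apply/asboolP; rewrite -/(word_eqb _ _) -[word_eqb _ _]/(word_equiv _ _)
  -(eqmodE word_equiv) /prepr /pclass reprK.
Qed.
Lemma preprK : cancel prepr pclass.
Proof. by move=> x; rewrite /pclass /prepr reprK. Qed.
Lemma pclass_eq u v : pclass u = pclass v <-> word_eqv R u v.
Proof.
split=> [uv|uv]; last by apply/eqmodP/asboolP.
by apply/asboolP; move/eqmodP: uv.
Qed.

Definition pone : presented := pclass [::].
Definition pmul (x y : presented) := pclass (prepr x ++ prepr y).
Definition pinv (x : presented) := pclass (winv (prepr x)).

Lemma pmul_pclass u v : pmul (pclass u) (pclass v) = pclass (u ++ v).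
Proof. by apply/pclass_eq/Weqv_cat; apply: prepr_pclass. Qed.

Lemma pmulA : associative pmul.
Proof.
by move=> x y z; rewrite -[x]preprK -[y]preprK -[z]preprK !pmul_pclass catA.
Qed.
Lemma pmul1 : left_id pone pmul.
Proof. by move=> x; rewrite -[x]preprK pmul_pclass. Qed.
Lemma pmulr1 : right_id pone pmul.
Proof. by move=> x; rewrite -[x]preprK pmul_pclass cats0. Qed.

Lemma winvK u : winv (winv u) = u.
Proof.
rewrite /winv map_rev revK -map_comp map_id_in // => -[i b] _ /=.
by rewrite negbK.
Qed.
Lemma winvr u : word_eqv R (u ++ winv u) [::].
Proof.
elim: u => [|[i b] u IH]; first exact: Weqv_refl.
have -> : ((i, b) :: u) ++ winv ((i, b) :: u) =
          [:: (i, b)] ++ ((u ++ winv u) ++ [:: (i, ~~ b)]).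
  by rewrite /winv /= rev_cons -cats1 catA.
apply: (Weqv_trans (v := [:: (i, b)] ++ ([::] ++ [:: (i, ~~ b)]))).
  by apply/Weqv_cat/Weqv_cat => //; apply: Weqv_refl.
exact: Weqv_cancel.
Qed.
Lemma pmulVx : left_inverse pone pinv pmul.
Proof.
move=> x; rewrite -{2}[x]preprK pmul_pclass; apply/pclass_eq.
by rewrite -{2}[prepr x]winvK; apply: winvr.
Qed.
Lemma pmulxV : right_inverse pone pinv pmul.
Proof.
move=> x; rewrite -{1}[x]preprK pmul_pclass; apply/pclass_eq/winvr.
Qed.

HB.instance Definition _ :=
  isGroup.Build presented pmulA pmul1 pmulr1 pmulVx pmulxV.

Definition pgen (i : I) : presented := pclass [:: (i, false)].

(* The universal property.                                                    *)
Variables (G : groupType) (f : I -> G).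

Definition weval (u : word I) : G :=
  \prod_(a <- u) (if a.2 then (f a.1)^-1 else f a.1).
Definition plift (x : presented) : G := weval (prepr x).

Lemma weval_cat u v : weval (u ++ v) = weval u * weval v.
Proof. exact: big_cat. Qed.

Hypothesis fR : forall u v, R u v -> weval u = weval v.

Lemma weval_eqv u v : word_eqv R u v -> weval u = weval v.
Proof.
elim=> {u v} //= [v u w _ -> _ //|u1 v1 u2 v2 _ e1 _ e2|i b].
  by rewrite !weval_cat e1 e2.
by rewrite /weval !big_cons big_nil mulg1 /=; case: b; rewrite ?mulgV ?mulVg.
Qed.

Lemma plift_pclass u : plift (pclass u) = weval u.
Proof. exact/weval_eqv/prepr_pclass. Qed.

Lemma pliftM : {morph plift : x y / x * y}.
Proof.
move=> x y; rewrite -[x]preprK -[y]preprK [_ * _]pmul_pclass !plift_pclass.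
exact: weval_cat.
Qed.
Lemma plift_gen i : plift (pgen i) = f i.
Proof. by rewrite plift_pclass /weval big_seq1. Qed.

End Presented.

Inductive generated (G : groupType) (S : G -> Prop) : G -> Prop :=
| Gen_mem x : S x -> generated S x
| Gen_one : generated S 1
| Gen_div x y : generated S x -> generated S y -> generated S (x * y^-1).

Section Generated.
Variables (G : groupType) (S : G -> Prop).
Definition in_generated : pred G := fun x => `[< generated S x >].
Lemma generated_closed : group_closed in_generated.
Proof.
split; first exact/asboolP/Gen_one.
by move=> x y /asboolP Sx /asboolP Sy; apply/asboolP/Gen_div.
Qed.
Definition generated_group := {x : G | in_generated x}.
HB.instance Definition _ := SubChoice.on generated_group.
HB.instance Definition _ :=
  SubChoice_isSubGroup.Build G in_generated generated_group generated_closed.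
End Generated.

(* Strands and generators are numbered from 0: strands are elements of 'I_n,  *)
(* and the generator k : 'I_n.-1 exchanges the strands k and k.+1, so that it *)
(* is the classical sigma_(k+1).                                              *)
Inductive braid_rel (n : nat) : word 'I_n.-1 -> word 'I_n.-1 -> Prop :=
| Braid_far (i j : 'I_n.-1) : i.+1 < j ->
    braid_rel [:: (i, false); (j, false)] [:: (j, false); (i, false)]
| Braid_near (i j : 'I_n.-1) : j = i.+1 :> nat ->
    braid_rel [:: (i, false); (j, false); (i, false)]
              [:: (j, false); (i, false); (j, false)].

Definition braid (n : nat) := presented (@braid_rel n).
HB.instance Definition _ n := Group.on (braid n).

Definition sigma (n : nat) (k : 'I_n.-1) : braid n := pgen (@braid_rel n) k.

Lemma strandS_subproof (n : nat) (k : 'I_n.-1) : k.+1 < n.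
Proof. by rewrite -ltn_predRL. Qed.

Definition adj_tperm (n : nat) (k : 'I_n.-1) : 'S_n :=
  tperm (widen_ord (leq_pred n) k) (Ordinal (strandS_subproof k)).

Definition braid_perm (n : nat) : braid n -> 'S_n :=
  @plift _ (@braid_rel n) _ (@adj_tperm n).

Lemma adj_tperm_rel n (u v : word 'I_n.-1) :
  braid_rel u v -> weval (@adj_tperm n) u = weval (@adj_tperm n) v.
Proof.
case=> i j ij; rewrite /weval !big_cons !big_nil /= !mulg1.
  rewrite [RHS]conjgC; congr (_ * _); rewrite tpermJ !tpermD //;
  by rewrite -val_eqE /= ?eqSS neq_ltn ?ij ?(ltnW ij) ?(leq_trans (ltnW ij)) ?orbT.
rewrite /adj_tperm.
have -> : widen_ord (leq_pred n) j = Ordinal (strandS_subproof i).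
  exact/val_inj.
set x := widen_ord _ _; set y := Ordinal _; set z := Ordinal _.
have xy : x != y by rewrite -val_eqE /= neq_ltn ltnSn.
have yz : y != z by rewrite -val_eqE /= ij neq_ltn ltnSn.
have xz : x != z by rewrite -val_eqE /= ij neq_ltn leqnSn.
transitivity (tperm y z ^ tperm x y).
  by rewrite /conjg tpermV mulgA.
transitivity (tperm x y ^ tperm y z).
  by rewrite !tpermJ tpermR tpermL !tpermD // eq_sym.
by rewrite /conjg tpermV mulgA.
Qed.

Lemma braid_permM n : {morph @braid_perm n : x y / x * y}.
Proof. exact/pliftM/adj_tperm_rel. Qed.
HB.instance Definition _ n :=
  isMultiplicative.Build (braid n) ('S_n : groupType) (@braid_perm n)
    (@braid_permM n).

Lemma braid_perm_sigma n (k : 'I_n.-1) : braid_perm (sigma k) = adj_tperm k.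
Proof. exact/plift_gen/adj_tperm_rel. Qed.

Lemma braid_perm1 n : braid_perm (1 : braid n) = 1.
Proof. by apply: (mulgI (braid_perm 1)); rewrite -braid_permM !mulg1. Qed.

Lemma braid_permV n (x : braid n) : braid_perm x^-1 = (braid_perm x)^-1.
Proof.
by apply: (mulgI (braid_perm x)); rewrite -braid_permM !mulgV braid_perm1.
Qed.

Definition is_pure (n : nat) : pred (braid n) :=
  fun x => braid_perm x == 1.

Lemma is_pure_closed n : group_closed (@is_pure n).
Proof.
split=> [|x y]; rewrite /is_pure /in_mem /= ?braid_perm1 //.
by move=> /eqP x1 /eqP y1; rewrite braid_permM braid_permV x1 y1 mulgV.
Qed.

Definition pure_braid (n : nat) := {x : braid n | is_pure x}.
HB.instance Definition _ n := SubChoice.on (pure_braid n).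
HB.instance Definition _ n :=
  SubChoice_isSubGroup.Build (braid n) (@is_pure n) (pure_braid n)
    (@is_pure_closed n).

(* A i j, for strands i < j < n: the conjugating element is                   *)
(* sigma (j - 1) * ... * sigma (i + 1), indices decreasing from left to right.*)
Definition braidA (n : nat) (i : 'I_n.-1) (j : nat) : braid n :=
  let w := \prod_(k <- rev (enum 'I_n.-1) | i < k < j) sigma k in
  w * sigma i ^+ 2 * w^-1.

Lemma braidA_pure n (i : 'I_n.-1) j : is_pure (braidA i j).
Proof.
rewrite /is_pure /braidA expg2 !braid_permM braid_permV braid_perm_sigma.
by rewrite tperm2 mulg1 mulgV.
Qed.

Definition pureA (n : nat) (i : 'I_n.-1) (j : nat) : pure_braid n :=
  Sub (braidA i j) (braidA_pure i j).

(* The generators are the A i j in which j is the last strand n - 1.          *)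
Definition pureU (n : nat) :=
  generated_group (fun x : pure_braid n => exists i, x = pureA i n.-1).
HB.instance Definition _ n := Group.on (pureU n).

Definition inclU (n : nat) : pureU n -> pure_braid n := \val.
HB.instance Definition _ n :=
  isMultiplicative.Build (pureU n) (pure_braid n) (@inclU n) (@valM _ _ _).

(* Main.v *)
Require Import Defs.
From HB Require Import structures.
From mathcomp Require Import all_boot all_fingroup boolp.

(** Write x_i for A_(i,4), a free generator of U_4, and let psi be
    the transvection of U_4 sending x_2 to x_2 x_1 and fixing x_1 and x_3.
    In P_4 the element A_(2,3) commutes with A_(1,4) and conjugates A_(2,4) to
    A_(3,4)^-1 A_(2,4) A_(3,4).  If an endomorphism phi of P_4 extended
    psi, then g = phi(A_(2,3)) would commute with A_(1,4) and conjugate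
    A_(2,4) A_(1,4) to A_(3,4)^-1 A_(2,4) A_(1,4) A_(3,4), so that
      A_(3,4) (g A_(2,4) g^-1) A_(1,4) = A_(2,4) A_(1,4) A_(3,4).
    Forgetting the second strand kills every conjugate of A_(2,4) in P_4, and
    would make A_(1,4) and A_(3,4) commute as pure braids on three strands.
    They do not: they act on a free group by noncommuting Artin automorphisms.

    Two facts about braids given by generators and relations are needed: that
    U_4 is free on the A_(i,4), so that psi exists, and that the second strand
    can be forgotten.  Both come from one construction, strand_act, an action
    of the braid group on pairs (p, h), where p is the position of a followed
    strand and h records what the other strands have undergone.  When h lies in
    a free group with one generator for each other strand, on which the others
    act through Artin automorphisms, two choices are of interest.

    - In push_system, the followed strand moreover multiplies h on the left by
      the generator of each strand that it passes from right to left.  Then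
      A_(i,n) acts on the pairs (n, h) as left multiplication by the i-th
      generator, and reading off the multiplier is a homomorphism from U_4 to
      the free group (pureU_coord), whence the universal property of U_4.
    - In forget_system, passing the followed strand has no effect on h.  A pure
      braid preserves the position p, and on the pairs with p the second
      strand it acts as the pure braid in which that strand is erased. *)

Set Implicit Arguments.
Unset Strict Implicit.
Unset Printing Implicit Defensive.
Local Open Scope group_scope.

(** * Presented groups, their morphisms and their actions *)

Lemma presented_ind (I : choiceType) (R : word I -> word I -> Prop)
    (P : presented R -> Prop) :
    P 1 -> (forall i x, P x -> P (pgen R i * x)) ->
    (forall i x, P x -> P ((pgen R i)^-1 * x)) -> forall x, P x.
Proof.
move=> P1 Pgen PgenV x; rewrite -[x]preprK.
elim: (prepr x) => [//|[i b] w Pw].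
suff -> : pclass R ((i, b) :: w) =
    (if b then (pgen R i)^-1 else pgen R i) * pclass R w.
  by case: b; [apply: PgenV | apply: Pgen].
rewrite -cat1s -pmul_pclass; congr (_ * _); case: b => //.
apply/esym/mulg1_eq; rewrite [_ * _]pmul_pclass.
exact/pclass_eq/Weqv_cancel.
Qed.

Section GroupMorphism.
Variables (G H : groupType) (f : G -> H).
Hypothesis fM : {morph f : x y / x * y}.

Lemma group_morph1 : f 1 = 1.
Proof. by apply: (mulgI (f 1)); rewrite -fM !mulg1. Qed.

Lemma group_morphV : {morph f : x / x^-1}.
Proof. by move=> x; apply/esym/mulg1_eq; rewrite -fM mulgV group_morph1. Qed.

Lemma group_morphJ : {morph f : x y / x ^ y}.
Proof. by move=> x y; rewrite !conjgE !fM group_morphV. Qed.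

End GroupMorphism.

Lemma presented_hom_eq (I : choiceType) (R : word I -> word I -> Prop)
    (G : groupType) (f g : presented R -> G) :
  {morph f : x y / x * y} -> {morph g : x y / x * y} ->
  (forall i, f (pgen R i) = g (pgen R i)) -> f =1 g.
Proof.
move=> fM gM fg; elim/presented_ind => [|i x IH|i x IH].
- by rewrite (group_morph1 fM) (group_morph1 gM).
- by rewrite fM gM fg IH.
- by rewrite fM gM (group_morphV fM) (group_morphV gM) fg IH.
Qed.

(** A presented group acts on X as soon as its generators act by bijections that
    satisfy the relations.  The action is on the left: the last letter of a word
    acts first. *)
Section PresentedAction.
Variables (I : choiceType) (R : word I -> word I -> Prop) (X : Type).
Variables f f' : I -> X -> X.
Hypotheses (fK : forall i, cancel (f i) (f' i))
           (f'K : forall i, cancel (f' i) (f i)).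

Definition word_act (w : word I) (x : X) : X :=
  foldr (fun a => if a.2 then f' a.1 else f a.1) x w.

Hypothesis fR : forall u v, R u v -> word_act u =1 word_act v.

Lemma word_act_cat u v x : word_act (u ++ v) x = word_act u (word_act v x).
Proof. exact: foldr_cat. Qed.

Lemma word_act_eqv u v : word_eqv R u v -> word_act u =1 word_act v.
Proof.
elim=> {u v} //= [u v _ uv x|v u w _ uv _ vw x|u1 v1 u2 v2 _ e1 _ e2 x|i b x].
- by rewrite uv.
- by rewrite uv vw.
- by rewrite !word_act_cat e2 e1.
- by rewrite /word_act; case: b => /=; rewrite ?fK ?f'K.
Qed.

Definition presented_act (g : presented R) : X -> X := word_act (prepr g).

Lemma presented_act_pclass w : presented_act (pclass R w) =1 word_act w.
Proof. exact/word_act_eqv/prepr_pclass. Qed.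

Lemma presented_act1 x : presented_act 1 x = x.
Proof. exact: presented_act_pclass. Qed.

Lemma presented_actM g h x :
  presented_act (g * h) x = presented_act g (presented_act h x).
Proof.
by rewrite -[g]preprK -[h]preprK [_ * _]pmul_pclass !presented_act_pclass
  word_act_cat.
Qed.

Lemma presented_act_gen i x : presented_act (pgen R i) x = f i x.
Proof. exact: presented_act_pclass. Qed.

End PresentedAction.

(** * Following one strand of a braid *)

(** The data for an action of braids on pairs (p, h), p being the position of a
    followed strand and h : H a state of the other strands.  The other strands
    are numbered in their order of position, skipping the followed one:
    cross k is the effect on H of the exchange of the other strands k and k + 1,
    and push k that of the followed strand moving from position k + 1 to k,
    that is past the other strand k.  The move from k to k + 1 has no effect on
    H, so that push k is also the effect of a full turn around the other
    strand k.  The last six fields are the braid relations, sorted by the place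
    of the followed strand relative to the crossings. *)
Record strand_system (H : Type) := StrandSystem {
  cross : nat -> H -> H;
  uncross : nat -> H -> H;
  push : nat -> H -> H;
  unpush : nat -> H -> H;
  crossK : forall k, cancel (cross k) (uncross k);
  uncrossK : forall k, cancel (uncross k) (cross k);
  pushK : forall k, cancel (push k) (unpush k);
  unpushK : forall k, cancel (unpush k) (push k);
  cross_far : forall i j h, i.+1 < j ->
    cross i (cross j h) = cross j (cross i h);
  cross_near : forall i h,
    cross i (cross i.+1 (cross i h)) = cross i.+1 (cross i (cross i.+1 h));
  cross_push_lt : forall i j h, i < j -> cross j (push i h) = push i (cross j h);
  cross_push_gt : forall i j h, i.+1 < j ->
    cross i (push j h) = push j (cross i h);
  cross_push_move : forall i h, cross i (push i h) = push i.+1 (cross i h);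
  cross_push_pair : forall i h,
    cross i (push i (push i.+1 h)) = push i (push i.+1 (cross i h)) }.

Section StrandAction.
Variables (H : Type) (S : strand_system H).
Local Notation s := (cross S).
Local Notation s' := (uncross S).
Local Notation m := (push S).
Local Notation m' := (unpush S).

(** When the followed strand lies to the left of both strands that cross, these
    are the other strands k - 1 and k, whence the predecessor. *)
Definition strand_step (k : nat) (x : nat * H) : nat * H :=
  let: (p, h) := x in
  if p == k then (k.+1, h) else if p == k.+1 then (k, m k h)
  else (p, if p < k then s k.-1 h else s k h).

Definition strand_step_inv (k : nat) (x : nat * H) : nat * H :=
  let: (p, h) := x in
  if p == k then (k.+1, m' k h) else if p == k.+1 then (k, h)
  else (p, if p < k then s' k.-1 h else s' k h).

Lemma strand_stepL k h : strand_step k (k, h) = (k.+1, h).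
Proof. by rewrite /= eqxx. Qed.

Lemma strand_stepR k h : strand_step k (k.+1, h) = (k, m k h).
Proof. by rewrite /= eqxx -[_ == k]/(k.+1 == k) gtn_eqF. Qed.

Lemma strand_step_below k p h : p < k -> strand_step k (p, h) = (p, s k.-1 h).
Proof. by move=> pk; rewrite /= pk !ltn_eqF // ltnS ltnW. Qed.

Lemma strand_step_above k p h : k.+1 < p -> strand_step k (p, h) = (p, s k h).
Proof.
move=> kp; have kp' := ltnW kp.
by rewrite /= (gtn_eqF kp') (gtn_eqF kp) ltnNge (ltnW kp').
Qed.

Lemma strand_stepK k : cancel (strand_step k) (strand_step_inv k).
Proof.
case=> p h /=; case: (eqVneq p k) => [->|pk] /=.
  by rewrite eqxx gtn_eqF.
case: (eqVneq p k.+1) => [->|pk1] /=; first by rewrite eqxx pushK.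
by rewrite (negPf pk) (negPf pk1); case: (p < k); rewrite crossK.
Qed.

Lemma strand_step_invK k : cancel (strand_step_inv k) (strand_step k).
Proof.
case=> p h /=; case: (eqVneq p k) => [->|pk] /=.
  by rewrite eqxx gtn_eqF // unpushK.
case: (eqVneq p k.+1) => [->|pk1] /=; first by rewrite eqxx.
by rewrite (negPf pk) (negPf pk1); case: (p < k); rewrite uncrossK.
Qed.

Lemma strand_step_far i j x : i.+1 < j ->
  strand_step i (strand_step j x) = strand_step j (strand_step i x).
Proof.
case: x => p h ij; have ij' := ltnW ij.
have ij1 : i < j.-1 by rewrite -ltnS prednK // (leq_trans _ ij).
have [pi|pi|->] := ltngtP p i.
- have pj := ltn_trans pi ij'.
  rewrite !(strand_step_below _ pi, strand_step_below _ pj) cross_far //.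
  by case: i ij1 pi {ij ij' pj}.
- have [//|ip|->] := ltngtP p i.+1; first by rewrite ltnS leqNgt pi.
    have [pj|jp|->] := ltngtP p j.
    + have pj1 : p <= j.-1 by rewrite -ltnS prednK // (leq_trans _ ij).
      rewrite !(strand_step_below _ pj, strand_step_above _ ip) cross_far //.
      exact: leq_trans ip pj1.
    + have [//|pj1|->] := ltngtP p j.+1; first by rewrite ltnS leqNgt jp.
        by rewrite !(strand_step_above _ pj1, strand_step_above _ ip) cross_far.
      have ijS := leqW ij.
      rewrite strand_stepR (strand_step_above _ ij) (strand_step_above _ ijS).
      by rewrite strand_stepR cross_push_gt.
    + have ijS := leqW ij.
      by rewrite strand_stepL (strand_step_above _ ij) (strand_step_above _ ijS)
        strand_stepL.
  rewrite (strand_step_below _ ij) !strand_stepR (strand_step_below _ ij').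
  by rewrite cross_push_lt.
- by rewrite (strand_step_below _ ij') !strand_stepL (strand_step_below _ ij).
Qed.

Lemma strand_step_near i x :
  strand_step i (strand_step i.+1 (strand_step i x)) =
  strand_step i.+1 (strand_step i (strand_step i.+1 x)).
Proof.
case: x => p h.
have [pi|pi|->] := ltngtP p i; last 1 first.
- rewrite !strand_stepL (strand_step_above _ (ltnSn i.+1)).
  by rewrite (strand_step_below _ (ltnSn i)) !strand_stepL.
- have lpi := leqW pi.
  rewrite !(strand_step_below _ pi, strand_step_below _ lpi).
  by case: i pi {lpi} => [//|i] _; rewrite cross_near.
have [//|ip|->] := ltngtP p i.+1; first by rewrite ltnS leqNgt pi.
- have [//|ip2|->] := ltngtP p i.+2; first by rewrite ltnS leqNgt ip.
  + by rewrite !(strand_step_above _ ip, strand_step_above _ ip2) cross_near.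
  + rewrite (strand_step_above _ (ltnSn i.+1)) !strand_stepR.
    by rewrite (strand_step_below _ (ltnSn i)) cross_push_pair.
- rewrite strand_stepR (strand_step_below _ (ltnSn i)) !strand_stepL.
  by rewrite (strand_step_above _ (ltnSn i.+1)) strand_stepR cross_push_move.
Qed.

Variable n : nat.

Let gen_step (k : 'I_n.-1) := strand_step k.
Let gen_step_inv (k : 'I_n.-1) := strand_step_inv k.

Lemma strand_step_rel (u v : word 'I_n.-1) : braid_rel u v ->
  word_act gen_step gen_step_inv u =1 word_act gen_step gen_step_inv v.
Proof.
case=> i j ij x; rewrite /word_act /gen_step [LHS]/foldr [RHS]/foldr.
  exact: strand_step_far.
by rewrite [fst _]/= ij; apply: strand_step_near.
Qed.

Definition strand_act : braid n -> nat * H -> nat * H :=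
  @presented_act _ (@braid_rel n) _ gen_step gen_step_inv.

Let gen_stepK k : cancel (gen_step k) (gen_step_inv k).
Proof. exact: strand_stepK. Qed.

Let gen_step_invK k : cancel (gen_step_inv k) (gen_step k).
Proof. exact: strand_step_invK. Qed.

Lemma strand_act1 x : strand_act 1 x = x.
Proof. exact: (presented_act1 gen_stepK gen_step_invK strand_step_rel). Qed.

Lemma strand_actM g h x : strand_act (g * h) x = strand_act g (strand_act h x).
Proof. exact: (presented_actM gen_stepK gen_step_invK strand_step_rel). Qed.

Lemma strand_actVE g x y : strand_act g x = y -> strand_act g^-1 y = x.
Proof. by move=> <-; rewrite -strand_actM mulVg strand_act1. Qed.

Lemma strand_act_sigma k x : strand_act (sigma k) x = strand_step k x.
Proof. exact: (presented_act_gen gen_stepK gen_step_invK strand_step_rel). Qed.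

Lemma strand_act_sigmaV k x : strand_act (sigma k)^-1 x = strand_step_inv k x.
Proof. by apply: strand_actVE; rewrite strand_act_sigma strand_step_invK. Qed.

Lemma strand_step_pos (k : 'I_n.-1) (p : 'I_n) h :
  ((strand_step k (val p, h)).1 = adj_tperm k p) *
  ((strand_step_inv k (val p, h)).1 = adj_tperm k p).
Proof.
rewrite /adj_tperm /=; case: tpermP => [->|->|/eqP + /eqP].
- by rewrite /= eqxx.
- by rewrite /= eqxx gtn_eqF.
by rewrite -!val_eqE /= => /negPf -> /negPf ->.
Qed.

(** The inverse reconciles two conventions: the first factor of a product of
    permutations is applied first, the last letter of a braid acts first. *)
Lemma strand_act_pos g (p : 'I_n) h :
  (strand_act g (val p, h)).1 = (braid_perm g)^-1 p.
Proof.
move: g p h; apply: presented_ind => [p h|k g IH p h|k g IH p h].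
- by rewrite strand_act1 braid_perm1 invg1 perm1.
- rewrite strand_actM strand_act_sigma braid_permM invMg permM.
  rewrite (surjective_pairing (strand_act g _)) IH strand_step_pos.
  by rewrite -[pgen _ k]/(sigma k) braid_perm_sigma tpermV.
- rewrite strand_actM strand_act_sigmaV braid_permM invMg permM.
  rewrite (surjective_pairing (strand_act g _)) IH strand_step_pos.
  by rewrite -[pgen _ k]/(sigma k) braid_permV braid_perm_sigma invgK.
Qed.

Lemma strand_act_pure (g : pure_braid n) p h : p < n ->
  exists h', strand_act (val g) (p, h) = (p, h').
Proof.
move=> pn; exists (strand_act (val g) (p, h)).2.
rewrite [LHS]surjective_pairing; congr (_, _).
rewrite (strand_act_pos _ (Ordinal pn)).
by rewrite (eqP (valP g)) invg1 perm1.
Qed.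

End StrandAction.

(** * Artin automorphisms of the free group *)

Definition free_group (I : choiceType) := presented (fun _ _ : word I => False).
HB.instance Definition _ (I : choiceType) := Group.on (free_group I).

Section FreeGroup.
Variable I : choiceType.

Definition free_gen (i : I) : free_group I := pgen _ i.

Definition free_lift (G : groupType) (f : I -> G) : free_group I -> G := plift f.

Lemma free_liftM (G : groupType) (f : I -> G) :
  {morph free_lift f : x y / x * y}.
Proof. by apply: pliftM. Qed.

Lemma free_lift_gen (G : groupType) (f : I -> G) i :
  free_lift f (free_gen i) = f i.
Proof. by apply: plift_gen. Qed.

Lemma free_hom_eq (G : groupType) (f g : free_group I -> G) :
  {morph f : x y / x * y} -> {morph g : x y / x * y} ->
  (forall i, f (free_gen i) = g (free_gen i)) -> f =1 g.
Proof. exact: presented_hom_eq. Qed.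

End FreeGroup.

(** Infinitely many generators give a single family of automorphisms that
    serves braids on any number of strands, without bounds on the indices. *)
Local Notation F := (free_group nat).
Local Notation x_ k := (@free_gen nat k%N : F).

(** The Artin automorphism of the crossing i: it fixes the product
    x_i x_(i+1) of the two loops, and sends x_i to x_(i+1). *)
Definition artin (i : nat) : F -> F := free_lift (fun k =>
  if k == i then x_ i.+1 else if k == i.+1 then x_ i ^ x_ i.+1 else x_ k).

Definition artin_inv (i : nat) : F -> F := free_lift (fun k =>
  if k == i then x_ i.+1 ^ (x_ i)^-1 else if k == i.+1 then x_ i else x_ k).

Lemma artinM i : {morph artin i : x y / x * y}.
Proof. exact: free_liftM. Qed.

Lemma artin_invM i : {morph artin_inv i : x y / x * y}.
Proof. exact: free_liftM. Qed.

Lemma artinL i : artin i (x_ i) = x_ i.+1.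
Proof. by rewrite /artin free_lift_gen eqxx. Qed.

Lemma artinR i : artin i (x_ i.+1) = x_ i ^ x_ i.+1.
Proof. by rewrite /artin free_lift_gen eqxx gtn_eqF. Qed.

Lemma artin_lt i k : k < i -> artin i (x_ k) = x_ k.
Proof. by move=> ki; rewrite /artin free_lift_gen !ltn_eqF // leqW. Qed.

Lemma artin_gt i k : i.+1 < k -> artin i (x_ k) = x_ k.
Proof.
by move=> ik; rewrite /artin free_lift_gen (gtn_eqF ik) (gtn_eqF (ltnW ik)).
Qed.

Lemma artinK i : cancel (artin i) (artin_inv i).
Proof.
apply: (free_hom_eq (g := id)) => [x y|//|k]; first by rewrite artinM artin_invM.
rewrite /artin free_lift_gen; case: (eqVneq k i) => [->|ki].
  by rewrite /artin_inv free_lift_gen eqxx gtn_eqF.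
case: (eqVneq k i.+1) => [->|ki1].
  rewrite (group_morphJ (@artin_invM i)) /artin_inv !free_lift_gen !eqxx gtn_eqF //.
  by rewrite conjgKV.
by rewrite /artin_inv free_lift_gen (negPf ki) (negPf ki1).
Qed.

Lemma artin_invK i : cancel (artin_inv i) (artin i).
Proof.
apply: (free_hom_eq (g := id)) => [x y|//|k]; first by rewrite artin_invM artinM.
rewrite {1}/artin_inv free_lift_gen; case: (eqVneq k i) => [->|ki].
  rewrite (group_morphJ (@artinM i)) (group_morphV (@artinM i)) artinL artinR.
  by rewrite conjgK.
case: (eqVneq k i.+1) => [->|ki1]; first by rewrite artinL.
by rewrite /artin free_lift_gen (negPf ki) (negPf ki1).
Qed.

Lemma artin_far i j x : i.+1 < j -> artin i (artin j x) = artin j (artin i x).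
Proof.
move=> ij; have ij' := ltnW ij.
move: x; apply: free_hom_eq => [x y|x y|k]; rewrite ?artinM //.
have [ki|ik|->] := ltngtP k i.
- by rewrite !(artin_lt ki, artin_lt (ltn_trans ki ij')).
- have [//|ik1|->] := ltngtP k i.+1; first by rewrite ltnS leqNgt ik.
    have [kj|jk|->] := ltngtP k j.
    + by rewrite !(artin_lt kj, artin_gt ik1).
    + have [//|jk1|->] := ltngtP k j.+1; first by rewrite ltnS leqNgt jk.
        by rewrite !(artin_gt jk1, artin_gt ik1).
      rewrite artinR (artin_gt (leqW ij)) artinR (group_morphJ (@artinM i)).
      by rewrite (artin_gt ij) (artin_gt (leqW ij)).
    + by rewrite artinL (artin_gt ij) (artin_gt (leqW ij)) artinL.
  rewrite (artin_lt ij) artinR (group_morphJ (@artinM j)).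
  by rewrite (artin_lt ij) (artin_lt ij').
- by rewrite (artin_lt ij') artinL (artin_lt ij).
Qed.

Lemma artin_near i x :
  artin i (artin i.+1 (artin i x)) = artin i.+1 (artin i (artin i.+1 x)).
Proof.
move: x; apply: free_hom_eq => [x y|x y|k]; rewrite ?artinM //.
have gt2 := artin_gt (ltnSn i.+1); have lt1 := artin_lt (ltnSn i).
have [ki|ik|->] := ltngtP k i.
- by rewrite !(artin_lt ki, artin_lt (leqW ki)).
- have [//|ik1|->] := ltngtP k i.+1; first by rewrite ltnS leqNgt ik.
    have [//|ik2|->] := ltngtP k i.+2; first by rewrite ltnS leqNgt ik1.
      by rewrite !(artin_gt ik1, artin_gt ik2).
    rewrite gt2 artinR !(group_morphJ (@artinM _)) artinR gt2.
    by rewrite (group_morphJ (@artinM _)) lt1 artinL artinR -conjJg.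
  rewrite artinR (group_morphJ (@artinM _)) lt1 artinL.
  by rewrite (group_morphJ (@artinM _)) artinL gt2 artinR.
- by rewrite artinL artinL gt2 lt1 artinL artinL.
Qed.

(** The followed strand going around two neighbours does not see their
    crossing, because the Artin automorphism fixes x_i x_(i+1). *)
Lemma artin_push_pair i h :
  artin i (x_ i * (x_ i.+1 * h)) = x_ i * (x_ i.+1 * artin i h).
Proof. by rewrite !artinM artinL artinR mulgA -conjgC mulgA. Qed.

(** The point-pushing action: the followed strand moves among the others, and h
    collects the loop that it describes. *)
Definition push_system : strand_system F.
Proof.
apply: (@StrandSystem F artin artin_inv (fun k h => x_ k * h)
  (fun k h => (x_ k)^-1 * h)).
- exact: artinK.
- exact: artin_invK.
- by move=> k; apply: mulKg.
- by move=> k; apply: mulVKg.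
- by move=> i j h; apply: artin_far.
- exact: artin_near.
- by move=> i j h ij; rewrite artinM artin_lt.
- by move=> i j h ij; rewrite artinM artin_gt.
- by move=> i h; rewrite artinM artinL.
- exact: artin_push_pair.
Defined.

(** The followed strand is erased, and the others act by Artin automorphisms. *)
Definition forget_system : strand_system F.
Proof.
apply: (@StrandSystem F artin artin_inv (fun=> id) (fun=> id)) => //.
- exact: artinK.
- exact: artin_invK.
- by move=> i j h; apply: artin_far.
- exact: artin_near.
Defined.

(** * Identities in the braid group *)

(* Strands are numbered from 0, so that A_ k is A_(k+1,4), the element
   A_(2,3) is sigma4 1 ^+ 2 and the second strand is at position 1. *)
Local Notation sigma4 k := (@sigma 4 (@Ordinal 3 k isT)).
Local Notation A_ k := (@pureA 4 (@Ordinal 3 k isT) 3).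

Lemma braidA4 (i : 'I_3) :
  braidA (n := 4) i 3 =
  nth 1 [:: sigma4 2 * sigma4 1 * sigma4 0 ^+ 2 * (sigma4 2 * sigma4 1)^-1;
            sigma4 2 * sigma4 1 ^+ 2 * (sigma4 2)^-1; sigma4 2 ^+ 2] i.
Proof.
have E : enum 'I_3 = [:: @Ordinal 3 0 isT; @Ordinal 3 1 isT; @Ordinal 3 2 isT].
  by apply: (inj_map val_inj); rewrite val_enum_ord.
rewrite /braidA [enum _]E /rev /= !big_cons big_nil.
by case: i => [[|[|[|i]]] // ilt] /=; rewrite ?mulg1 ?mul1g ?invg1 ?mulg1;
  congr (_ * sigma _ ^+ 2 * _) || congr (sigma _ ^+ 2); apply: val_inj.
Qed.

Lemma sigma_far n (i j : 'I_n.-1) : i.+1 < j -> commute (sigma i) (sigma j).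
Proof.
move=> ij; rewrite /commute ![_ * _]pmul_pclass.
exact/pclass_eq/Weqv_rel/(Braid_far ij).
Qed.

Lemma sigma_near n (i j : 'I_n.-1) : j = i.+1 :> nat ->
  sigma i * sigma j * sigma i = sigma j * sigma i * sigma j.
Proof.
move=> ij; rewrite [sigma i * _]pmul_pclass [LHS]pmul_pclass.
rewrite [sigma j * _]pmul_pclass [RHS]pmul_pclass.
exact/pclass_eq/Weqv_rel/(Braid_near ij).
Qed.

Section BraidIdentities.
Variables (G : groupType) (a b c : G).
Hypotheses (ab : a * b * a = b * a * b) (cb : commute c b).

Let ab2 : a ^+ 2 * (b * a) = (b * a) * b ^+ 2.
Proof. by rewrite !expg2 -[LHS]mulgA (mulgA a b) ab !mulgA ab. Qed.

(** For a, b, c the second, third and first generators of B_4: A_(2,3) commutes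
    with A_(1,4), because b a turns a ^+ 2 into b ^+ 2, which commutes with c. *)
Lemma sqr_commute_conj : commute (a ^+ 2) (b * a * c ^+ 2 * (b * a)^-1).
Proof.
have -> : a ^+ 2 = (b * a) * b ^+ 2 * (b * a)^-1 by rewrite -ab2 mulgK.
have := commuteX2 2 2 cb; move: (b * a) (b ^+ 2) (c ^+ 2) => w B C CB.
by rewrite /commute !mulgA !mulgVK -!(mulgA w) CB.
Qed.

(** A_(2,3) A_(2,4) A_(3,4) is the full twist on three strands, so that A_(2,3)
    acts on A_(2,4) as the inverse of A_(2,4) A_(3,4).  The proof goes through
    the second form a^-1 b ^+ 2 a of A_(2,4). *)
Lemma sqr_conj_braid :
  a ^+ 2 * (b * a ^+ 2 * b^-1) =
  (b ^+ 2)^-1 * (b * a ^+ 2 * b^-1) * b ^+ 2 * a ^+ 2.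
Proof.
have E : b * a ^+ 2 * b^-1 = a^-1 * b ^+ 2 * a.
  apply/(mulgI a)/(mulIg b); rewrite !expg2 !mulgA mulgVK mulgV mul1g ab.
  by rewrite -!mulgA; congr (_ * _); rewrite !mulgA.
rewrite {1}E; apply: (mulgI b).
have -> : b * (a ^+ 2 * (a^-1 * b ^+ 2 * a)) = b * a * b * b * a.
  by rewrite !expg2 !mulgA mulgK.
rewrite !expg2 invMg !mulgA mulgV mul1g mulVg mul1g mulgVK.
by rewrite -(mulgA a a b) -(mulgA a (a * b)) ab !mulgA -ab.
Qed.

End BraidIdentities.

Local Notation u_ k := (val (A_ k)).

Lemma A23_commute_A14 : commute (sigma4 1 ^+ 2) (u_ 0).
Proof.
rewrite [val _]braidA4 /=; apply: sqr_commute_conj; first exact: sigma_near.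
exact: sigma_far.
Qed.

Lemma A23_conj_A24 :
  sigma4 1 ^+ 2 * u_ 1 = (u_ 2)^-1 * u_ 1 * u_ 2 * sigma4 1 ^+ 2.
Proof.
by rewrite ![val _]braidA4 /=; apply: sqr_conj_braid; apply: sigma_near.
Qed.

Lemma strand_act_conj n H (S : strand_system H) (g w : braid n) x y z :
  strand_act S w y = x -> strand_act S g y = z ->
  strand_act S (w * g * w^-1) x = strand_act S w z.
Proof. by move=> wy gy; rewrite !strand_actM (strand_actVE wy) gy. Qed.

(** * The free group U_4 *)

(** The followed strand goes, without effect, to the right of the strand i,
    turns around it, and comes back the same way. *)
Lemma push_act_gen (i : 'I_3) h :
  strand_act push_system (braidA (n := 4) i 3) (3, h) =
  (3, free_gen (i : nat) * h).
Proof.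
rewrite braidA4; case: i => [[|[|[|i]]] // ilt] /=.
- rewrite (strand_act_conj (y := (1%N, h)) (z := (1%N, x_ 0 * h)));
    by rewrite ?expg2 !strand_actM !strand_act_sigma.
- rewrite (strand_act_conj (y := (2, h)) (z := (2, x_ 1 * h)));
    by rewrite ?expg2 ?strand_actM !strand_act_sigma.
- by rewrite expg2 strand_actM !strand_act_sigma.
Qed.

Definition pureU_gen (i : 'I_3) : pureU 4 :=
  Sub (pureA (n := 4) i 3) (introT (asboolP _) (Gen_mem (ex_intro _ i erefl))).

Lemma pureU_ind (P : pureU 4 -> Prop) :
  P 1 -> (forall i, P (pureU_gen i)) ->
  (forall u v, P u -> P v -> P (u * v^-1)) -> forall u, P u.
Proof.
move=> P1 Pgen Pdiv u.
suff H x : Defs.generated (fun x : pure_braid 4 => exists i, x = pureA i 3) x ->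
    forall v : pureU 4, \val v = x -> P v.
  by apply: H erefl; apply/asboolP/(valP u).
elim=> {x u} [x [i ->] v|v|x y Gx IHx Gy IHy v].
- by move=> vE; have -> : v = pureU_gen i by apply: val_inj.
- by move=> vE; have -> : v = 1 by apply: val_inj.
pose vx : pureU 4 := Sub x (introT (asboolP _) Gx).
pose vy : pureU 4 := Sub y (introT (asboolP _) Gy).
move=> vE; have -> : v = vx * vy^-1 by apply: val_inj.
by apply: Pdiv; [apply: IHx | apply: IHy].
Qed.

Lemma pureU_hom_eq (G : groupType) (f g : pureU 4 -> G) :
  {morph f : x y / x * y} -> {morph g : x y / x * y} ->
  (forall i, f (pureU_gen i) = g (pureU_gen i)) -> f =1 g.
Proof.
move=> fM gM fg; apply: pureU_ind => [|//|u v fu fv].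
  by rewrite (group_morph1 fM) (group_morph1 gM).
by rewrite fM gM (group_morphV fM) (group_morphV gM) fu fv.
Qed.

Local Notation push_act u := (strand_act push_system (\val (\val u))).

(** The action of U_4 on the last strand is by left multiplications; the
    multiplier is the image of the neutral element. *)
Definition pureU_coord (u : pureU 4) : F := (push_act u (3, 1)).2.

Lemma pureU_coordE u h : push_act u (3, h) = (3, pureU_coord u * h).
Proof.
move: h; suff [w uE] : exists w, forall h, push_act u (3, h) = (3, w * h).
  by move=> h; rewrite /pureU_coord !uE mulg1.
move: u; apply: pureU_ind => [|i|u v [w uE] [z vE]].
- by exists 1 => h; rewrite strand_act1 mul1g.
- by exists (x_ i) => h; apply: push_act_gen.
exists (w * z^-1) => h; rewrite strand_actM.
have -> : push_act v^-1 (3, h) = (3, z^-1 * h).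
  by apply: strand_actVE; rewrite vE mulVKg.
by rewrite uE mulgA.
Qed.

Lemma pureU_coordM : {morph pureU_coord : u v / u * v}.
Proof.
move=> u v; rewrite {1}/pureU_coord.
by rewrite strand_actM !pureU_coordE mulg1.
Qed.

Lemma pureU_coord_gen i : pureU_coord (pureU_gen i) = x_ i.
Proof. by rewrite /pureU_coord [strand_act _ _ _]push_act_gen mulg1. Qed.

(** The universal property that makes U_4 free on its three generators, here
    numbered by 0, 1 and 2. *)
Definition pureU_lift (G : groupType) (f : nat -> G) (u : pureU 4) : G :=
  free_lift f (pureU_coord u).

Lemma pureU_liftM (G : groupType) (f : nat -> G) :
  {morph pureU_lift f : u v / u * v}.
Proof. by move=> u v; rewrite /pureU_lift pureU_coordM free_liftM. Qed.

Lemma pureU_lift_gen (G : groupType) (f : nat -> G) i :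
  pureU_lift f (pureU_gen i) = f i.
Proof. by rewrite /pureU_lift pureU_coord_gen free_lift_gen. Qed.

Local Notation g_ k := (pureU_gen (@Ordinal 3 k isT)).

Definition transvection (z : pureU 4) : pureU 4 -> pureU 4 :=
  pureU_lift (nth 1 [:: g_ 0; g_ 1 * z; g_ 2]).

Lemma transvectionM z : {morph transvection z : u v / u * v}.
Proof. exact: pureU_liftM. Qed.

HB.instance Definition _ z :=
  isMultiplicative.Build (pureU 4) (pureU 4) (transvection z) (@transvectionM z).

Lemma transvection_gen z :
  (transvection z (g_ 0) = g_ 0) * (transvection z (g_ 1) = g_ 1 * z) *
  (transvection z (g_ 2) = g_ 2).
Proof. by rewrite /transvection !pureU_lift_gen. Qed.

(** The composite sends g_ 1 to g_ 1 * z * w. *)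
Lemma transvectionK z w : transvection z w = w -> z * w = 1 ->
  cancel (transvection w) (transvection z).
Proof.
move=> zw zw1; apply: (pureU_hom_eq (g := id)) => [u v|//|i].
  by rewrite !transvectionM.
have [->|->|->] : [\/ i = @Ordinal 3 0 isT, i = @Ordinal 3 1 isT
                     | i = @Ordinal 3 2 isT].
  case: i => [[|[|[|i]]] // ilt];
    [constructor 1|constructor 2|constructor 3]; exact: val_inj.
- by rewrite !transvection_gen.
- by rewrite transvection_gen transvectionM transvection_gen zw -mulgA zw1 mulg1.
- by rewrite !transvection_gen.
Qed.

Lemma transvection_bij : bijective (transvection (g_ 0)).
Proof.
have fV z : transvection z (g_ 0)^-1 = (g_ 0)^-1.
  by rewrite (group_morphV (@transvectionM z)) transvection_gen.
exists (transvection (g_ 0)^-1); apply: transvectionK.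
- by rewrite transvection_gen.
- by rewrite mulVg.
- exact: fV.
- by rewrite mulgV.
Qed.

(** * Forgetting the second strand *)

Local Notation forget_act := (strand_act forget_system).

Lemma forget_act_A14 h :
  forget_act (u_ 0) (1%N, artin 1 h) = (1%N, artin 1 (artin 0 (artin 0 h))).
Proof.
rewrite [val _]braidA4 /= (strand_act_conj (y := (2, h))
  (z := (2, artin 0 (artin 0 h))));
  by rewrite ?expg2 !strand_actM !strand_act_sigma.
Qed.

Lemma forget_act_A24 h : forget_act (u_ 1) (1%N, h) = (1%N, h).
Proof.
rewrite -[h](artin_invK 1) [val _]braidA4 /=.
by rewrite (strand_act_conj (y := (1%N, artin_inv 1 h))
                            (z := (1%N, artin_inv 1 h)));
  rewrite ?expg2 ?strand_actM !strand_act_sigma.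
Qed.

Lemma forget_act_A34 h :
  forget_act (u_ 2) (1%N, h) = (1%N, artin 1 (artin 1 h)).
Proof. by rewrite [val _]braidA4 /= expg2 strand_actM !strand_act_sigma. Qed.

(** The pure braid g^-1 keeps the followed strand second, and there A_(2,4)
    acts trivially. *)
Lemma forget_act_conj_A24 (g : pure_braid 4) h :
  forget_act (val g * u_ 1 * (val g)^-1) (1%N, h) = (1%N, h).
Proof.
have [h' gE] : exists h', forget_act (val g)^-1 (1%N, h) = (1%N, h').
  exact: (strand_act_pure forget_system g^-1 h).
rewrite strand_actM (strand_actM _ (val g)) gE forget_act_A24 -gE -strand_actM.
by rewrite mulgV strand_act1.
Qed.

(** As the square of artin 1 fixes x_0, this says that the squares of artin 0 and
    artin 1 do not commute.  The two sides already differ in the symmetric group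
    on three letters, after the generators are sent to transpositions. *)
Lemma artin_sqr_noncommuting :
  artin 1 (artin 1 (artin 0 (artin 0 (x_ 0)))) <> artin 0 (artin 0 (x_ 0)).
Proof.
rewrite artinL artinR !(group_morphJ (@artinM _)) !artinL artinR.
rewrite !(artin_lt (ltnSn _)).
pose o0 := @Ordinal 3 0 isT; pose o1 := @Ordinal 3 1 isT.
pose o2 := @Ordinal 3 2 isT.
move/(congr1 (free_lift (fun k => nth 1
  [:: tperm o0 o1; tperm o0 o1; tperm o1 o2] k : 'S_3))).
rewrite !(group_morphJ (free_liftM _)) !free_lift_gen /=.
rewrite !conjgE !invMg !tpermV => /permP/(_ o0).
by rewrite !permM !permE.
Qed.

(** Since g commutes with x, conjugating y x by g only affects y; the second
    hypothesis says that it amounts to conjugating by z^-1. *)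
Lemma conj_of_commute (G : groupType) (g x y z : G) :
  commute g x -> g * (y * x) = z^-1 * (y * x) * z * g ->
  z * (g * y * g^-1) * x = y * x * z.
Proof.
move=> gx gyx; apply: (mulIg g); rewrite -(mulgA _ x) -gx -(mulgA z).
have -> : g * y * g^-1 * (g * x) = g * (y * x) by rewrite !mulgA mulgVK.
by rewrite gyx !mulgA mulgV mul1g.
Qed.

Lemma A23_pure : @is_pure 4 (sigma4 1 ^+ 2).
Proof. by rewrite /is_pure expg2 braid_permM braid_perm_sigma tperm2. Qed.

Theorem theorem5p6 :
  exists psi : {multiplicative pureU 4 -> pureU 4}, bijective psi /\
    ~ exists phi : {multiplicative pure_braid 4 -> pure_braid 4},
        bijective phi /\ forall u : pureU 4, phi (inclU u) = inclU (psi u).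
Proof.
exists (transvection (g_ 0)); split; first exact: transvection_bij.
case=> phi [_ phiE].
have phiM : {morph phi : x y / x * y} by apply: gmulfM.
have phiU u : phi (inclU u) = inclU (transvection (g_ 0) u) := phiE u.
have phi0 : phi (A_ 0) = A_ 0.
  by rewrite -[A_ 0]/(inclU (g_ 0)) phiU transvection_gen.
have phi1 : phi (A_ 1) = A_ 1 * A_ 0.
  by rewrite -[A_ 1]/(inclU (g_ 1)) phiU transvection_gen; apply: val_inj.
have phi2 : phi (A_ 2) = A_ 2.
  by rewrite -[A_ 2]/(inclU (g_ 2)) phiU transvection_gen.
pose k : pure_braid 4 := Sub (sigma4 1 ^+ 2) A23_pure.
have /(congr1 phi) : k * A_ 0 = A_ 0 * k.
  by apply: val_inj; apply: A23_commute_A14.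
have /(congr1 phi) : k * A_ 1 = (A_ 2)^-1 * A_ 1 * A_ 2 * k.
  by apply: val_inj; apply: A23_conj_A24.
rewrite !phiM (group_morphV phiM) phi0 phi1 phi2.
move: (phi k) => g gA1 gA0.
have /(congr1 val) E := conj_of_commute gA0 gA1.
have := forget_act_A24; have := forget_act_A34; have := forget_act_A14.
pose w : braid 4 := val g * u_ 1 * (val g)^-1.
have := forget_act_conj_A24 g : forall h, forget_act w (1%N, h) = (1%N, h).
have {E} : u_ 2 * w * u_ 0 = u_ 1 * u_ 0 * u_ 2 := E.
move: w (u_ 0) (u_ 1) (u_ 2) => w v0 v1 v2 E wE v0E v2E v1E.
(* The point artin 1 (x_ 0) is chosen so that A_(1,4), which acts as the
   conjugate of the square of artin 0 by artin 1, unwinds on it. *)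
have fix0 : artin 1 (x_ 0) = x_ 0 by apply: artin_lt.
have : forget_act (v2 * w * v0) (1%N, artin 1 (x_ 0)) =
       forget_act (v1 * v0 * v2) (1%N, artin 1 (x_ 0)) by rewrite E.
rewrite !strand_actM v0E wE !v2E !fix0 -{2}fix0 v0E v1E => -[].
by move/(can_inj (artinK 1)); apply: artin_sqr_noncommuting.
Qed.
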